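(* Let $G\subseteq[0,1]$ be a $G_\delta$ set and let $\mathcal{C}_G$ be the set of all functions $f:[0,1]\to\mathbb{R}$ whose set of continuity points is exactly $G$. Then $\mathcal{C}_G$ is strongly $\mathfrak{c}$-algebrable (as a subset of the algebra $\mathbb{R}^{[0,1]}$).
   Context: $\mathfrak{c}=2^{\omega}$ is the cardinality of the continuum. $\mathbb{R}^{[0,1]}$ is the real commutative algebra of all functions $[0,1]\to\mathbb{R}$ with pointwise operations. A subset $S$ of a commutative real algebra $\mathcal{L}$ is strongly $\kappa$-algebrable if $S\cup\{0\}$ contains a $\kappa$-generated algebra isomorphic to a free (commutative, non-unital) algebra; equivalently, there is a set $X\subseteq\mathcal{L}$ of cardinality $\kappa$ such that for every $k\ge 1$, every nonzero real polynomial $P$ in $k$ variables without constant term and all distinct $y_1,\dots,y_k\in X$, we have $P(y_1,\dots,y_k)\neq 0$ and $P(y_1,\dots,y_k)\in S$. *)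

(* Defs.v *)
From HB Require Import structures.
From mathcomp Require Import all_boot all_order all_algebra.
From mathcomp Require Import all_classical all_reals all_analysis.
(* The notations of mpoly clash with those of mathcomp-analysis. *)
From mathcomp Require Import -(notations) mpoly.

Set Implicit Arguments.
Unset Strict Implicit.
Unset Printing Implicit Defensive.

Import Order.TTheory GRing.Theory Num.Theory.
Import numFieldNormedType.Exports.

Local Open Scope classical_set_scope.
Local Open Scope ring_scope.

(* As a subtype of R, it carries the topology induced by the inclusion. *)
Notation unit_interval R := (set_type (`[0, 1]%classic : set R)).

Fact zero_in_unit_interval (R : realType) :
  (0 : R) \in (`[0, 1]%classic : set R).
Proof. by rewrite mem_setE bound_itvE ler01. Qed.

(* The library makes T -> R a (nontrivial) ring only for a pointed T. *)
HB.instance Definition _ (R : realType) :=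
  isPointed.Build (unit_interval R) (SigSub (zero_in_unit_interval R)).

(* The ring and module structures of T -> A are already in the library. *)
Fact fct_scalerAl (T : pointedType) (K : comNzRingType) (A : comAlgType K)
  (a : K) (f g : T -> A) : a *: (f * g) = (a *: f) * g.
Proof. by apply/funext => x; exact: scalerAl. Qed.

HB.instance Definition _ (T : pointedType) (K : comNzRingType)
    (A : comAlgType K) :=
  @GRing.Lmodule_isLalgebra.Build K (T -> A) (@fct_scalerAl T K A).
HB.instance Definition _ (T : pointedType) (K : comNzRingType)
    (A : comAlgType K) :=
  GRing.Lalgebra_isComAlgebra.Build K (T -> A).

(* [kappa] is a type whose cardinality is the cardinal in question.
   mmap evaluates P at y in A, mapping the coefficients to A by c |-> c *: 1;
   as the constant term mcoeff mnm0 P vanishes, the value lies in the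
   non-unital algebra generated by y. *)
Definition strongly_algebrable (R : realType) (A : comAlgType R)
    (kappa : Type) (S : set A) : Prop :=
  exists2 X : set A, (X #= [set: kappa])%card &
    forall (k : nat) (P : mpoly k R) (y : 'I_k -> A),
      (0 < k)%N -> P != 0 -> mcoeff mnm0 P = 0 ->
      injective y -> (forall i, X (y i)) ->
      let Py := mmap (in_alg A) y P in Py != 0 /\ S Py.

(* A type of cardinality 2 ^ omega. *)
Definition continuum : Type := set nat.

Definition continuity_points (T U : topologicalType) (f : T -> U) : set T :=
  [set x | continuous_at x f].

Definition functions_continuous_exactly_on (R : realType) (G : set R) :
    set (unit_interval R -> R) :=
  [set f | [set set_val x | x in continuity_points f] = G].

(* Main.v *)
Require Import Defs.
From mathcomp Require Import all_boot all_order all_algebra.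
From mathcomp Require Import all_classical all_reals all_analysis.
From mathcomp Require Import borel_hierarchy.
From mathcomp Require Import zify ring lra.
From mathcomp Require Import -(notations) mpoly.

(** The generators are functions [f_A] indexed by the sets [A] of naturals.

    Write the complement of [G] as the union of increasing closed sets [H n],
    with [H 0] empty.  Fix a sequence [V] with values in [0, 1].  For a closed
    set [F], the function [osc F V] is continuous off [F], and in every
    neighbourhood of a point of [F] it takes the value [V k] for all large [k]:
    off [F] it is a piecewise linear wave in the inverse of the distance to [F]
    whose [k]-th crest has height [V k], and on [F] it sends the odd multiples
    of [2 ^ -k] to [V k].  The points where the value [V k] is taken do not
    depend on [V] ([osc_attains]), so several sequences are read off at the same
    points.

    The function [layered_sum H V] is the sum over [n] of
    [2 ^ -n * dist (H n) * osc (H n.+1) V], the distance being capped at 1.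
    The distances make all layers above the [n]-th vanish, continuously, at the
    points of [H n.+1], and the layers below the [n]-th are continuous at the
    points outside [H n].  Near a point [x] of [H n.+1] outside [H n] the sum is
    therefore [r + c * osc (H n.+1) V] with [r] continuous at [x] and [c]
    continuous with [c x > 0].  At a point of [G] all layers are continuous,
    hence so is the sum.

    Let [P] be a nonzero polynomial without constant term, and let [V_i] be
    sequences such that the tuple of the [V_i k] takes each of its values
    [w j] for infinitely many [k].  If the polynomial in the layered sums were
    continuous at such an [x], the cluster values [P (r_i x + c x * w_i j)]
    would all be equal ([meval_layered_sum_cluster]).

    It remains to find, for each [A], a sequence [w_A] such that, for distinct
    sets [A_i], the numbers [P (r_i + c * w_(A_i) j)] are not the same for all
    [j], whatever the reals [r_i] and [c != 0] ([weight_independent]).  Here [w_A j] is a power of [t = 1 / (j + 1)] whose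
    exponent [(s + 1) ^ c_A s] depends only on [A] and on [s = stage j], a
    number that takes each value infinitely often; the sequence fed to
    [layered_sum] is [w_A] composed with [stage].  For [s] large the codes
    [c_A s] of the sets in play are distinct and the degrees of [P] are digits
    in base [s + 1]; distinct monomials then become univariate polynomials in
    [t] of distinct degrees, so that [P] becomes a nonconstant polynomial in
    [t], which cannot be constant at infinitely many points.

    When [G] is all of [0, 1], continuous functions are needed: [f_A] is the
    wave with crests [w_A], evaluated at the inverse of twice the variable.  It
    is continuous at [0] because [w_A j] tends to [0]. *)

Set Implicit Arguments.
Unset Strict Implicit.
Unset Printing Implicit Defensive.

Import Order.TTheory GRing.Theory Num.Theory.
Import numFieldNormedType.Exports.

Local Open Scope classical_set_scope.
Local Open Scope ring_scope.

(** * Algebraic independence of powers with separated exponents *)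

(** Uniqueness of digits in base [B], for digits at arbitrary distinct
    positions: modulo [B ^ (c i).+1], where [i] is the lowest position at which
    the digits differ, the two sums differ only by their digits in position
    [i]. *)
Lemma sum_expn_inj (k B : nat) (c m m' : 'I_k -> nat) :
  injective c -> (forall i, m i < B)%N -> (forall i, m' i < B)%N ->
  (\sum_i m i * B ^ c i = \sum_i m' i * B ^ c i)%N -> m =1 m'.
Proof.
move=> c_inj mB m'B eqS i0; apply/eqP/negP => /negP neq_i0.
have [i neq_i min_i] := @arg_minnP _ i0 (fun i => m i != m' i) c neq_i0.
have B_gt0 : (0 < B)%N by exact: leq_ltn_trans (mB i0).
pose D j : int := (m j)%:Z - (m' j)%:Z.
have D0 : \sum_j D j * (B ^ c j)%:Z = 0.
  under eq_bigr do rewrite mulrBl -!PoszM.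
  rewrite sumrB; apply/eqP; rewrite subr_eq0; apply/eqP.
  by move/(congr1 Posz): eqS; rewrite !(big_morph Posz PoszD (erefl _)).
have dvd_other j : j != i -> ((B ^ (c i).+1)%:Z %| D j * (B ^ c j)%:Z)%Z.
  move=> ji; have [eqj|neqj] := eqVneq (m j) (m' j).
    by rewrite /D eqj subrr mul0r dvdz0.
  apply: dvdz_mull; rewrite dvdzE /= dvdn_exp2l // ltn_neqAle min_i // andbT.
  by apply: contra ji => /eqP/c_inj ->.
have : ((B ^ (c i).+1)%:Z %| D i * (B ^ c i)%:Z)%Z.
  move: D0; rewrite (bigD1 i) //= => /(canRL (addrK _)) ->.
  rewrite sub0r rpredN.
  by apply: rpred_sum => j; exact: dvd_other.
rewrite expnS PoszM dvdz_mul2r; last by rewrite -lt0n expn_gt0 B_gt0.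
rewrite dvdzE /=.
by move: (mB i) (m'B i) neq_i; rewrite /D => ? ? ? /dvdn_leq; lia.
Qed.

Lemma size_monomial_affine (F : fieldType) (k : nat) (a : 'I_k -> F) (c : F)
    (e m : 'I_k -> nat) : c != 0 -> (forall i, 0 < e i)%N ->
  size (\prod_i (c *: 'X^(e i) + (a i)%:P) ^+ m i)%R = (\sum_i m i * e i).+1%N.
Proof.
move=> c0 e_gt0.
apply: (big_ind2 (fun (p : {poly F}) n => size p = n.+1)).
- by rewrite size_poly1.
- move=> p n q n' sp sq; rewrite size_mul -?size_poly_eq0 ?sp ?sq //.
  by rewrite addSn addnS.
move=> i _; have sz : size (c *: 'X^(e i) + (a i)%:P) = (e i).+1.
  rewrite size_polyDl size_scale ?size_polyXn //.
  by rewrite (leq_ltn_trans (size_polyC_leq1 _)) // ltnS e_gt0.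
have p0 : (c *: 'X^(e i) + (a i)%:P) ^+ m i != 0.
  by rewrite expf_neq0 // -size_poly_eq0 sz.
rewrite -(@prednK (size _)) ?lt0n ?size_poly_eq0 // size_exp sz /=.
by rewrite mulnC.
Qed.

(** The monomials of [P] become univariate polynomials of pairwise distinct
    degrees, so the one of largest degree cannot be cancelled; that degree is
    positive because [P] has no constant term. *)
Lemma meval_affine_powers (F : fieldType) (k : nat) (P : mpoly k F)
    (a : 'I_k -> F) (c : F) (e : 'I_k -> nat) :
  P != 0 -> mcoeff mnm0 P = 0 -> c != 0 -> (forall i, 0 < e i)%N ->
  {in msupp P &, injective (fun m : multinom k => \sum_i m i * e i)%N} ->
  exists2 Q : {poly F}, (1 < size Q)%N &
    forall t, Q.[t] = meval (fun i => c * t ^+ e i + a i) P.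
Proof.
move=> P0 P00 c0 e_gt0 E_inj.
pose q (m : multinom k) := \prod_i (c *: 'X^(e i) + (a i)%:P) ^+ m i.
pose E (m : multinom k) := (\sum_i m i * e i)%N.
exists (\sum_(m <- msupp P) mcoeff m P *: q m); last first.
  move=> t; rewrite horner_sum /meval /mmap; apply: eq_bigr => m _.
  rewrite hornerZ horner_prod; congr (_ * _); apply: eq_bigr => i _.
  by rewrite horner_exp !hornerE.
have [m0 m0P] : exists m0, m0 \in msupp P.
  by exists (mlead P); rewrite mlead_supp.
have [m mP max_m] : exists2 m, m \in msupp P &
    forall m', m' \in msupp P -> (E m' <= E m)%N.
  have := @arg_maxnP _ (SeqSub m0P) xpredT (fun m => E (ssval m)) isT.
  case=> -[m mP] _ max_m; exists m => // m' m'P.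
  exact: (max_m (SeqSub m'P)).
have Em_gt0 : (0 < E m)%N.
  rewrite lt0n; apply: contraTneq mP => Em0.
  suff -> : m = mnm0 by rewrite -mcoeff_eq0 P00 eqxx.
  apply/mnmP => i; rewrite mnm0E; apply/eqP.
  move/eqP: Em0; rewrite sum_nat_eq0 => /forallP/(_ i) /=.
  by rewrite muln_eq0 (gtn_eqF (e_gt0 i)) orbF.
apply: leq_trans (_ : (E m).+1 <= _)%N => //.
rewrite ltnNge; apply/negP => /leq_sizeP/(_ _ (leqnn _)).
have sz_q m' : size (q m') = (E m').+1 by exact: size_monomial_affine.
rewrite coef_sum (bigD1_seq m) ?msupp_uniq //= big_seq_cond big1 => [|m'].
  rewrite addr0 coefZ => /eqP; rewrite mulf_eq0 mcoeff_eq0 mP /=.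
  have -> : (q m)`_(E m) = lead_coef (q m) by rewrite lead_coefE sz_q.
  by rewrite lead_coef_eq0 -size_poly_eq0 sz_q.
move=> /andP[m'P neq]; rewrite coefZ nth_default ?mulr0 // sz_q.
rewrite ltn_neqAle max_m // andbT; apply: contra neq => /eqP/E_inj.
by move=> /(_ m'P mP) ->.
Qed.

Lemma size_const_on_inj (F : fieldType) (Q : {poly F}) (u : nat -> F) (L : F) :
  injective u -> (forall l, Q.[u l] = L) -> (size Q <= 1)%N.
Proof.
move=> u_inj QL; suff /eqP : Q - L%:P == 0.
  by move/subr0_eq ->; exact: size_polyC_leq1.
apply/negPn/negP => p0.
pose rs := [seq u i | i <- iota 0 (size (Q - L%:P))].
suff : (size rs < size (Q - L%:P)%R)%N by rewrite size_map size_iota ltnn.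
apply: max_poly_roots => //; last by rewrite map_inj_uniq // iota_uniq.
by apply/allP => _ /mapP[i _ ->]; rewrite rootE !hornerE QL subrr.
Qed.

Definition prefix_code (A : set nat) (s : nat) : nat :=
  pickle [seq `[< A i >] | i <- iota 0 s].

Lemma prefix_code_inj (k : nat) (A : 'I_k -> set nat) : injective A ->
  exists s0, forall s, (s0 <= s)%N -> injective (fun i => prefix_code (A i) s).
Proof.
move=> A_inj.
have sep (ij : 'I_k * 'I_k) : exists n, ij.1 != ij.2 ->
    `[< A ij.1 n >] != `[< A ij.2 n >].
  have [_|neq] := eqVneq ij.1 ij.2; first by exists 0%N.
  apply: contrapT => same; move/eqP: neq; apply; apply: A_inj.
  apply/funext => n; apply/propext; apply: asbool_eq_equiv.
  apply: contrapT => /eqP ne.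
  by apply: same; exists n.
pose w ij := projT1 (cid (sep ij)).
exists (\max_ij w ij).+1 => s le_s i j.
move=> /(pcan_inj pickleK) eq_ij; apply/eqP/negPn/negP => neq.
have := projT2 (cid (sep (i, j))) neq; rewrite -/(w (i, j)).
have wlt : (w (i, j) < s)%N by rewrite (leq_trans _ le_s) // ltnS leq_bigmax.
move/(congr1 (fun t => nth false t (w (i, j)))): eq_ij.
by rewrite !(nth_map 0%N) ?size_iota // nth_iota // add0n => ->; rewrite eqxx.
Qed.

(** A function on the naturals that takes each value infinitely often. *)
Definition stage (k : nat) := logn 2 k.

Lemma stage_odd_multiple s l : stage (2 ^ s * (2 * l).+1) = s.
Proof.
rewrite /stage lognM ?expn_gt0 // pfactorK // lognE /= dvdn2 /=.
by rewrite mul2n /= odd_double /= addn0.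
Qed.

Lemma stage_recurrent s j0 : exists2 j, (j0 <= j)%N & stage j = s.
Proof.
exists (2 ^ s * (2 * j0).+1)%N; last exact: stage_odd_multiple.
by have := expn_gt0 2 s; nia.
Qed.

(** The exponent depends on [k] through [stage k] alone: on each fibre of
    [stage] these are the values of a fixed power function at infinitely many
    points. *)
Definition weight (R : realType) (A : set nat) (k : nat) : R :=
  k.+1%:R^-1 ^+ ((stage k).+1 ^ prefix_code A (stage k))%N.

Lemma weight_bounds (R : realType) (A : set nat) (k : nat) :
  0 <= weight R A k <= k.+1%:R^-1.
Proof.
rewrite /weight exprn_ge0 ?invr_ge0 ?ler0n //=.
rewrite -[leRHS]expr1 ler_wiXn2l ?invr_ge0 ?ler0n ?invf_le1 ?ler1n ?ltr0n //.
by rewrite expn_gt0.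
Qed.

Lemma weight_unit (R : realType) (A : set nat) (k : nat) :
  0 <= weight R A k <= 1.
Proof.
have /andP[-> /le_trans] := weight_bounds R A k.
by apply; rewrite invf_le1 ?ler1n ?ltr0n.
Qed.

(** Only the indices of one stage [s] are used, large enough to separate the
    sets [A i] and to bound the exponents occurring in [P]. *)
Lemma weight_independent (R : realType) (k : nat) (P : mpoly k R)
    (A : 'I_k -> set nat) (a : 'I_k -> R) (c L : R) :
  P != 0 -> mcoeff mnm0 P = 0 -> injective A -> c != 0 ->
  ~ forall j, meval (fun i => c * weight R (A i) j + a i) P = L.
Proof.
move=> P0 P00 A_inj c0 PL.
have [s0 code_inj] := prefix_code_inj A_inj.
pose B := (\max_(m <- msupp P) \max_i m i)%N.
pose s := maxn s0 B.
have ltB m i : m \in msupp P -> (m i < s.+1)%N.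
  move=> mP; rewrite ltnS leq_max; apply/orP; right.
  apply: leq_trans (leq_bigmax i) _.
  exact: (@leq_bigmax_seq _ _ xpredT
    (fun m : multinom k => \max_i m i)%N m mP isT).
have [i|m m' mP m'P eqE|Q szQ QE] := @meval_affine_powers R k P a c
  (fun i => s.+1 ^ prefix_code (A i) s)%N P0 P00 c0.
- by rewrite expn_gt0.
- apply/mnmP.
  apply: sum_expn_inj eqE; [|by move=> i; exact: ltB..].
  by apply: code_inj; rewrite leq_maxl.
pose u l := (2 ^ s * (2 * l).+1).+1%:R^-1 : R.
suff : (size Q <= 1)%N by rewrite leqNgt szQ.
apply: (@size_const_on_inj _ _ u L) => [l l' /invr_inj/eqP|l].
  by rewrite eqr_nat eqSS eqn_pmul2l ?expn_gt0 // eqSS eqn_pmul2l // => /eqP.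
rewrite QE -(PL (2 ^ s * (2 * l).+1)%N); apply: meval_eq => i.
by rewrite /weight stage_odd_multiple.
Qed.

(** * Tent waves *)

Section Tent.
Variable R : realType.
Implicit Types (V : nat -> R) (z : R).

(** For [z >= 0], the graph over the interval between [n] and [n.+1] is a
    triangle with base at height [0] and apex [V n]. *)
Definition tent V z : R :=
  let n := Num.truncn z in
  V n * (2 * Num.min (z - n%:R) (n.+1%:R - z)).

Lemma tent_half V k : tent V (k%:R + 2^-1) = V k.
Proof.
have -> : tent V (k%:R + 2^-1) = V k *
    (2 * Num.min (k%:R + 2^-1 - k%:R) (k.+1%:R - (k%:R + 2^-1))).
  rewrite /tent (@truncn_def _ _ k) //.
  by rewrite -(natr1 k); apply/andP; split; lra.
rewrite -(natr1 k) [X in Num.min X _](_ : _ = 2^-1); last by lra.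
rewrite [X in Num.min _ X](_ : _ = 2^-1); last by lra.
by rewrite minxx divff ?mulr1 // pnatr_eq0.
Qed.

Lemma tent_bounds V z : (forall k, 0 <= V k <= 1) -> 0 <= z ->
  [/\ 0 <= tent V z, tent V z <= V (Num.truncn z),
      tent V z <= 2 * (z - (Num.truncn z)%:R) &
      tent V z <= 2 * ((Num.truncn z).+1%:R - z)].
Proof.
move=> /(_ (Num.truncn z)) /andP[V0 V1] z0; rewrite /tent.
have /andP[] := truncn_itv z0; set n := Num.truncn z in V0 V1 *.
rewrite -(natr1 n) => le_nz lt_zn; set t := 2 * _.
have [t0 t1 t2 t3] : [/\ 0 <= t, t <= 1, t <= 2 * (z - n%:R) &
    t <= 2 * (n%:R + 1 - z)].
  by rewrite /t; case: (leP (z - n%:R)) => h; split; lra.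
have Vt : V n * t <= t by rewrite -[leRHS]mul1r ler_wpM2r.
by split; [exact: mulr_ge0|rewrite ler_piMr|exact: le_trans Vt _..].
Qed.

Lemma tent_lipschitz V z z' : (forall k, 0 <= V k <= 1) ->
  0 <= z -> 0 <= z' -> `|tent V z - tent V z'| <= 2 * `|z - z'|.
Proof.
move=> V01; wlog zz' : z z' / z <= z' => [hw|] z0 z'0.
  have [zz'|/ltW z'z] := leP z z'; first exact: hw.
  by rewrite distrC [X in _ <= _ * X]distrC; exact: hw.
rewrite [X in _ <= _ * X]distrC (ger0_norm (_ : 0 <= z' - z)) ?subr_ge0 //.
have [t0 _ t1 t2] := tent_bounds V01 z0.
have [t0' _ t1' t2'] := tent_bounds V01 z'0.
have [eq_n|] := eqVneq (Num.truncn z) (Num.truncn z').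
  rewrite /tent -eq_n; have /andP[V0 V1] := V01 (Num.truncn z).
  set n := Num.truncn z in V0 V1 *.
  rewrite -mulrBr normrM (ger0_norm V0) -mulrBr normrM (ger0_norm (ler0n _ 2)).
  apply: (@le_trans _ _ (1 * (2 * (z' - z)))); last by rewrite mul1r.
  apply: ler_pM => //; apply: ler_wpM2l => //.
  rewrite ler_norml -(natr1 n).
  by case: (leP (z - _)) => ?; case: (leP (z' - _)) => ?;
    apply/andP; split; lra.
move=> neq; have lt_n : (Num.truncn z < Num.truncn z')%N.
  by rewrite ltn_neqAle neq le_truncn.
(* Between points of different intervals the wave returns to 0, so each of the
   two values is bounded by twice the distance to an intermediate integer. *)
have : (Num.truncn z).+1%:R <= (Num.truncn z')%:R :> R by rewrite ler_nat.
by move=> ?; rewrite ler_norml; apply/andP; split; lra.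
Qed.

End Tent.

(** * Truncated distance to a set *)

Section Distance.
Variable R : realType.
Implicit Types (F : set R) (y z : R).

(** The distance to [F] capped at 1: it is bounded, and positive when [F] is
    empty, as the first of an increasing sequence of closed sets may be. *)
Definition tdist F y : R := inf ([set `|y - z| | z in F] `|` [set 1]).

Let tdist_has_inf F y : has_inf ([set `|y - z| | z in F] `|` [set 1]).
Proof.
split; first by exists 1; right.
by exists 0 => _ [[z _ <-]|->].
Qed.

Lemma tdist_le F y z : F z -> tdist F y <= `|y - z|.
Proof.
move=> Fz; apply: ge_inf; first exact: (tdist_has_inf F y).2.
by left; exists z.
Qed.

Lemma tdist_le1 F y : tdist F y <= 1.
Proof. by apply: ge_inf; [exact: (tdist_has_inf F y).2|right]. Qed.

Lemma tdist_ge F y a : a <= 1 -> (forall z, F z -> a <= `|y - z|) ->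
  a <= tdist F y.
Proof.
move=> a1 aF; apply: lb_le_inf; first exact: (tdist_has_inf F y).1.
by move=> _ [[z Fz <-]|->] //; exact: aF.
Qed.

Lemma tdist_ge0 F y : 0 <= tdist F y.
Proof. exact: tdist_ge. Qed.

Lemma tdist_eq0 F y : F y -> tdist F y = 0.
Proof.
move=> Fy; apply/eqP; rewrite eq_le tdist_ge0 andbT.
by have := tdist_le y Fy; rewrite subrr normr0.
Qed.

Lemma tdist_gt0 F y : closed F -> ~ F y -> 0 < tdist F y.
Proof.
move=> cF nFy.
have /nbhs_ballP[e /= e0 eF] : nbhs y (~` F).
  by apply: open_nbhs_nbhs; split => //; exact: closed_openC.
apply: (@lt_le_trans _ _ (Num.min e 1)); first by rewrite lt_min e0 ltr01.
apply: tdist_ge => [|z Fz]; first by rewrite ge_min lexx orbT.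
rewrite ge_min leNgt; apply/orP; left; apply/negP => yze.
exact: (eF z).
Qed.

Lemma tdist_lipschitz F y y' : `|tdist F y - tdist F y'| <= `|y - y'|.
Proof.
have half x x' : tdist F x - `|x - x'| <= tdist F x'.
  apply: tdist_ge => [|z Fz].
    by apply: le_trans (tdist_le1 F x); rewrite gerBl.
  by rewrite lerBlDl; apply: le_trans (tdist_le x Fz) (ler_distD x' x z).
by rewrite ler_norml; have := half y y'; have := half y' y;
   rewrite (distrC y') => ? ?; apply/andP; split; lra.
Qed.

Lemma tdist_continuous F : continuous (tdist F).
Proof.
move=> y; apply/cvgrPdist_le => e e0; near=> z.
apply: le_trans (tdist_lipschitz F y z) _; near: z.
by apply: cvgr_dist_le => //; exact: cvg_id.
Unshelve. all: by end_near. Qed.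

End Distance.

(** * Functions oscillating at a closed set *)

Section Oscillation.
Variable R : realType.
Implicit Types (F : set R) (V : nat -> R) (x y : R).

(** A number is an odd multiple of [2 ^- a] for at most one [a], and every
    interval contains odd multiples of [2 ^- a] for all large [a]. *)
Definition dyadic_level y : nat :=
  xget 0%N [set a | exists m : nat, y * 2 ^+ a = m.*2.+1%:R].

Lemma dyadic_levelE y a (m : nat) :
  y * 2 ^+ a = m.*2.+1%:R -> dyadic_level y = a.
Proof.
rewrite /dyadic_level.
suff lt_contra b c (p q : nat) : y * 2 ^+ b = p.*2.+1%:R ->
    y * 2 ^+ c = q.*2.+1%:R ->
    ~ (b < c)%N.
  move=> ya; case: xgetP => [b _ [q yb]|/(_ a)]; last by case; exists m.
  have [||//] := ltngtP b a.
    by move/(lt_contra _ _ _ _ yb ya).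
  by move/(lt_contra _ _ _ _ ya yb).
move=> yb yc lt_bc.
have /eqP : (q.*2.+1)%:R = (p.*2.+1 * 2 ^ (c - b))%:R :> R.
  by rewrite natrM natrX -yb -mulrA -exprD subnKC // ltnW.
rewrite eqr_nat => /eqP/(congr1 odd); rewrite oddM oddX /= !odd_double.
by rewrite orbF subn_eq0 leqNgt lt_bc.
Qed.

Lemma dyadic_level_dense u v : 0 <= u -> u < v ->
  exists a0, forall a, (a0 <= a)%N -> exists2 y, u < y < v & dyadic_level y = a.
Proof.
move=> u0 uv; exists (Num.truncn (3 / (v - u))) => a le_a.
have pa0 : 0 < 2 ^+ a :> R by rewrite exprn_gt0.
pose m := Num.truncn (u * 2 ^+ a / 2).
have /andP[m1 m2] : m%:R <= u * 2 ^+ a / 2 < m.+1%:R.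
  by apply: truncn_itv; rewrite divr_ge0 // mulr_ge0 // ltW.
have big : 3 < (v - u) * 2 ^+ a.
  rewrite mulrC -ltr_pdivrMr ?subr_gt0 //; apply: lt_le_trans (truncnS_gt _) _.
  by rewrite -natrX ler_nat; apply: leq_ltn_trans le_a _; rewrite ltn_expl.
have mE : m.+1.*2.+1%:R = 2 * m%:R + 3 :> R.
  by rewrite -muln2 mulSn -[in RHS]natrM -natrD; congr _%:R; lia.
(* The second odd multiple of 2 ^ -a above u: the first may not exceed u. *)
exists (m.+1.*2.+1%:R / 2 ^+ a); last first.
  by apply: (@dyadic_levelE _ _ m.+1); rewrite divfK // gt_eqF.
rewrite ltr_pdivlMr // ltr_pdivrMr // mE.
by move: m2; rewrite -(natr1 m) => m2; apply/andP; split; lra.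
Qed.

(** Near an interior point of [F] there are no outside points to oscillate on;
    there the dyadic levels supply, in every interval, points carrying each
    large index. *)
Definition osc F V y : R :=
  if y \in F then V (dyadic_level y) else tent V (tdist F y)^-1.

Lemma osc_bounds F V y : (forall k, 0 <= V k <= 1) -> 0 <= osc F V y <= 1.
Proof.
move=> V01; rewrite /osc; case: ifP => // _.
have [|t0 t1 _ _] := tent_bounds (z := (tdist F y)^-1) V01.
  by rewrite invr_ge0 tdist_ge0.
by rewrite t0 (le_trans t1) // (andP (V01 _)).2.
Qed.

Lemma tent_continuous V z : (forall k, 0 <= V k <= 1) -> 0 < z ->
  {for z, continuous (tent V)}.
Proof.
move=> V01 z0; apply/cvgrPdist_le => e e0; near=> z'.
apply: le_trans (tent_lipschitz V01 _ _) _; first exact: ltW.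
  by near: z'; apply: cvgr_ge z0; exact: cvg_id.
rewrite -ler_pdivlMl //; near: z'.
by apply: cvgr_dist_le; [exact: cvg_id|rewrite mulr_gt0].
Unshelve. all: by end_near. Qed.

Lemma osc_continuous F V y : closed F -> (forall k, 0 <= V k <= 1) -> ~ F y ->
  {for y, continuous (osc F V)}.
Proof.
move=> cF V01 nFy; have d0 := tdist_gt0 cF nFy.
have oscE : \near y, (tent V \o (fun z => z^-1) \o tdist F) y = osc F V y.
  have : nbhs y (~` F).
    by apply: open_nbhs_nbhs; split => //; exact: closed_openC.
  by apply: filterS => z nFz; rewrite /osc memNset.
apply: cvg_trans (near_eq_cvg oscE) _; rewrite -(nbhs_singleton oscE).
apply: (@continuous_comp _ _ _ (tdist F)); first exact: tdist_continuous.
apply: continuous_comp; first by apply: inv_continuous; rewrite gt_eqF.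
by apply: tent_continuous => //; rewrite invr_gt0.
Qed.

(** Either points outside [F] accumulate at [x], and by the intermediate value
    theorem the inverse of the distance to [F] reaches the apex [k + 1/2] of
    every late triangle; or a neighbourhood of [x] lies in [F], and dyadic
    levels apply.  The point [y] is the same for all [V]. *)
Lemma osc_attains F x e : closed F -> F x -> 0 <= x <= 1 -> 0 < e ->
  exists k0, forall k, (k0 <= k)%N ->
    exists y, [/\ 0 <= y <= 1, `|x - y| < e & forall V, osc F V y = V k].
Proof.
move=> cF Fx /andP[x0 x1] e0.
have [[w [/andP[w0 w1] xw nFw]]|allF] :=
    pselect (exists w, [/\ 0 <= w <= 1, `|x - w| < e & ~ F w]).
  have dw0 := tdist_gt0 cF nFw.
  exists (Num.truncn (tdist F w)^-1).+1 => k le_k.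
  pose v : R := (k%:R + 2^-1)^-1.
  have v0 : 0 < v by rewrite invr_gt0 ltr_wpDl.
  have vdw : v <= tdist F w.
    rewrite -[leRHS]invrK lef_pV2 ?posrE ?invr_gt0 ?ltr_wpDl //.
    apply: ltW; apply: lt_le_trans (truncnS_gt _) _.
    by rewrite (@le_trans _ _ k%:R) ?ler_nat // lerDl.
  (* Along the segment from x to w the distance to F goes from 0 to a positive
     value. *)
  pose p (t : R) := x + t * (w - x).
  have cp : continuous (tdist F \o p).
    move=> t; apply: continuous_comp; last exact: tdist_continuous.
    apply: cvgD; first exact: cvg_cst.
    by apply: cvgM; [exact: cvg_id|exact: cvg_cst].
  have [||t] := @IVT _ (tdist F \o p) 0 1 v ler01.
  - exact: continuous_subspaceT.
  - rewrite /= /p mul0r addr0 mul1r subrKC (tdist_eq0 Fx).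
    by rewrite min_l ?max_r ?tdist_ge0 // vdw ltW.
  rewrite in_itv /= => /andP[t0 t1] dpt.
  exists (p t); split.
  - by rewrite /p; apply/andP; split; nra.
  - apply: le_lt_trans xw; rewrite /p opprD addrA subrr sub0r normrN normrM.
    by rewrite (ger0_norm t0) distrC ler_piMl.
  move=> V; rewrite /osc; case: ifPn => [/set_mem Fpt|_].
    by move: v0; rewrite -dpt /= tdist_eq0 // ltxx.
  by rewrite dpt invrK tent_half.
have inF w : 0 <= w <= 1 -> `|x - w| < e -> F w.
  by move=> w01 xw; apply: contrapT => nFw; apply: allF; exists w.
have [||a0 H] :=
  @dyadic_level_dense (Num.max 0 (x - e / 2)) (Num.min 1 (x + e / 2)).
- by rewrite le_max lexx.
- by rewrite lt_min !gt_max; apply/andP; split; apply/andP; split; lra.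
exists a0 => a /H[y]; rewrite gt_max lt_min => /andP[/andP[? ?] /andP[? ?]] ya.
have xy : `|x - y| < e by rewrite ltr_norml; apply/andP; split; lra.
have y01 : 0 <= y <= 1 by apply/andP; split; lra.
by exists y; split => // V; rewrite /osc mem_set ?ya //; exact: inF.
Qed.

End Oscillation.

(** * Evaluation of polynomials at functions *)

Lemma mmap_fctE (T : pointedType) (R : realType) (k : nat)
    (y : 'I_k -> T -> R) (P : mpoly k R) (t : T) :
  mmap (in_alg (T -> R)) y P t = meval (fun i => y i t) P.
Proof.
rewrite /meval /mmap fct_sumE; apply: eq_bigr => m _.
rewrite -[LHS]/((mcoeff m P * 1) * mmap1 y m t) mulr1; congr (_ * _).
rewrite /mmap1 (big_morph (fun f : T -> R => f t) (id1 := 1) (op1 := *%R)) //.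
by apply: eq_bigr => i _; elim: (m i) => [|n IH]; rewrite ?expr0 // !exprS -IH.
Qed.

Lemma meval_cvg (R : realType) (T : Type) (F : set_system T) (k : nat)
    (P : mpoly k R) (g : 'I_k -> T -> R) (l : 'I_k -> R) : Filter F ->
  (forall i, g i @ F --> l i) ->
  meval (fun i => g i t) P @[t --> F] --> meval l P.
Proof.
move=> FF gl; rewrite /meval /mmap.
have cX i n : g i t ^+ n @[t --> F] --> l i ^+ n.
  elim: n => [|n IH]; first exact: cvg_cst.
  rewrite exprS; under eq_cvg do rewrite exprS.
  by apply: cvgM.
apply: cvg_big => [|m _]; first exact: add_continuous.
apply: cvgM; first exact: cvg_cst.
apply: cvg_big => [|i _]; first exact: mul_continuous.
exact: cX.
Qed.

(** * Series dominated by a geometric series *)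

Section DominatedSeries.
Variable R : realType.
Implicit Types (u : R^nat).

Lemma series_geo_bounds u : (forall n, 0 <= u n <= 2^-1 ^+ n) ->
  cvgn (series u) /\
  forall n, series u n <= limn (series u) <= series u n + 2 * 2^-1 ^+ n.
Proof.
move=> u01.
have nd : {homo series u : n m / (n <= m)%N >-> n <= m}.
  apply/nondecreasing_seqP => n; rewrite /series /= big_nat_recr //= lerDl.
  exact: (andP (u01 n)).1.
have ub n m : (n <= m)%N -> series u m <= series u n + 2 * 2^-1 ^+ n.
  move=> /subnKC <-; move: (m - n)%N => d; elim: d n => [|d IH] n.
    by rewrite addn0 lerDl mulr_ge0 // exprn_ge0.
  rewrite addnS -addSn; apply: le_trans (IH _) _.
  rewrite /series /= big_nat_recr //= exprS.
  by have /andP[_] := u01 n; lra.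
have cv : cvgn (series u).
  apply: nondecreasing_is_cvgn => //; exists (series u 0 + 2 * 2^-1 ^+ 0).
  by move=> _ [m _ <-]; exact: ub.
split => // n; rewrite nondecreasing_cvgn_le //=.
by apply: limr_le => //; exists n => // m /=; exact: ub.
Qed.

Lemma series_continuous_at (T : topologicalType) (x : T) (u : nat -> T -> R) :
  (forall n y, 0 <= u n y <= 2^-1 ^+ n) ->
  (forall n, {for x, continuous (u n)}) ->
  {for x, continuous (fun y => limn (series (u ^~ y)))}.
Proof.
move=> u01 cu.
have cs n : {for x, continuous (fun y => series (u ^~ y) n)}.
  rewrite /series; apply: cvg_big => [|i _]; first exact: add_continuous.
  exact: cu.
apply/cvgrPdist_le => e e0.
have [n ne] : exists n, 2 * 2^-1 ^+ n <= e / 2 :> R.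
  exists (Num.truncn (4 / e)).
  rewrite exprVn -ler_pdivlMl // -[leRHS]invrK.
  rewrite lef_pV2 ?posrE ?invr_gt0 ?exprn_gt0 //;
    last by rewrite mulr_gt0 ?invr_gt0 ?divr_gt0.
  have -> : (2^-1 * (e / 2))^-1 = 4 / e :> R by field; rewrite gt_eqF.
  apply: ltW; apply: lt_le_trans (truncnS_gt _) _.
  by rewrite -natrX ler_nat ltn_expl.
near=> y.
have [_ /(_ n)/andP[x1 x2]] := series_geo_bounds (u01 ^~ x).
have [_ /(_ n)/andP[y1 y2]] := series_geo_bounds (u01 ^~ y).
have : `|series (u ^~ x) n - series (u ^~ y) n| <= e / 2.
  by near: y; move/cvgrPdist_le : (cs n); apply; rewrite divr_gt0.
by rewrite !ler_norml => /andP[? ?]; apply/andP; split; lra.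
Unshelve. all: by end_near. Qed.

Lemma lim_series_split u n : (forall j, 0 <= u j <= 2^-1 ^+ j) ->
  limn (series u) = u n + limn (series (fun j => if j == n then 0 else u j)).
Proof.
move=> u01; set v := fun j => _.
have v01 j : 0 <= v j <= 2^-1 ^+ j.
  by rewrite /v; case: ifP => // _; rewrite lexx exprn_ge0.
apply: cvg_lim => //.
have uvE : \forall m \near \oo, u n + series v m = series u m.
  exists n.+1 => // m /= lt_nm; rewrite /series /= !big_mkord.
  rewrite (bigD1 (Ordinal lt_nm)) //= [in RHS](bigD1 (Ordinal lt_nm)) //=.
  rewrite {1}/v eqxx add0r; congr (_ + _); apply: eq_bigr => i.
  by rewrite -val_eqE /v /= => /negbTE ->.
apply: cvg_trans (near_eq_cvg uvE) _.
by apply: cvgD; [exact: cvg_cst|exact: (series_geo_bounds v01).1].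
Qed.

End DominatedSeries.

(** * Layered sums over an increasing sequence of closed sets *)

Section LayeredSum.
Variable R : realType.
Implicit Types (H : nat -> set R) (V : nat -> R) (x y : R).

Definition layer H V y (n : nat) : R :=
  2^-1 ^+ n * tdist (H n) y * osc (H n.+1) V y.

Definition layered_sum H V y : R := limn (series (layer H V y)).

Definition other_layers H V n y : R :=
  limn (series (fun j => if j == n then 0 else layer H V y j)).

Lemma layer_bounds H V y n : (forall k, 0 <= V k <= 1) ->
  0 <= layer H V y n <= 2^-1 ^+ n.
Proof.
move=> V01; have /andP[osc0 osc1] := osc_bounds (H n.+1) y V01.
have p0 : 0 <= 2^-1 ^+ n :> R by rewrite exprn_ge0.
rewrite /layer !mulr_ge0 ?tdist_ge0 //= -mulrA ler_piMr //.
rewrite mulr_ile1 ?tdist_ge0 //.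
exact: tdist_le1.
Qed.

(** On [H n] the factor [tdist (H n)] vanishes and absorbs the oscillation. *)
Lemma layer_continuous H V n x : closed (H n.+1) -> (forall k, 0 <= V k <= 1) ->
  ~ H n.+1 x \/ H n x -> {for x, continuous (fun y => layer H V y n)}.
Proof.
move=> cH V01 [nHx|Hx].
  apply: cvgM; last exact: osc_continuous.
  by apply: cvgM; [exact: cvg_cst|exact: tdist_continuous].
have small y : `|layer H V x n - layer H V y n| <= `|x - y|.
  have /andP[osc0 osc1] := osc_bounds (H n.+1) y V01.
  rewrite {1}/layer tdist_eq0 // mulr0 mul0r sub0r normrN ger0_norm; last first.
    exact: (andP (layer_bounds H y n V01)).1.
  apply: le_trans (tdist_lipschitz (H n) x y).
  rewrite (tdist_eq0 Hx) sub0r normrN ger0_norm ?tdist_ge0 // /layer.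
  rewrite -mulrA mulrCA ler_piMr ?tdist_ge0 // mulr_ile1 ?exprn_ge0 //.
  by rewrite exprn_ile1 // invf_le1 // ler1n.
apply/cvgrPdist_le => e e0; near=> y; apply: le_trans (small y) _; near: y.
by apply: cvgr_dist_le => //; exact: cvg_id.
Unshelve. all: by end_near. Qed.

Lemma layered_sum_continuous H V x : (forall n, closed (H n)) ->
  (forall k, 0 <= V k <= 1) -> (forall n, ~ H n x) ->
  {for x, continuous (layered_sum H V)}.
Proof.
move=> cH V01 nHx.
apply: (@series_continuous_at _ _ _ (fun n y => layer H V y n)).
  by move=> n y; exact: layer_bounds.
by move=> n; apply: layer_continuous => //; left.
Qed.

Lemma other_layers_continuous H V n x : (forall n, closed (H n)) ->
  (forall j k, (j <= k)%N -> H j `<=` H k) ->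
  (forall k, 0 <= V k <= 1) -> H n.+1 x -> ~ H n x ->
  {for x, continuous (other_layers H V n)}.
Proof.
move=> cH mH V01 Hx nHx.
apply: (@series_continuous_at _ _ _
  (fun j y => if j == n then 0 else layer H V y j)).
  move=> j y; case: ifP => _; last exact: layer_bounds.
  by rewrite lexx exprn_ge0.
move=> j; case: (ltngtP j n) => [lt_jn|lt_nj|_]; last exact: cvg_cst.
  by apply: layer_continuous => //; left => /(mH _ _ lt_jn).
by apply: layer_continuous => //; right; exact: mH Hx.
Qed.

Lemma layered_sum_split H V n y : (forall k, 0 <= V k <= 1) ->
  layered_sum H V y = layer H V y n + other_layers H V n y.
Proof. by move=> V01; apply: lim_series_split => j; exact: layer_bounds. Qed.

Lemma comp_set_val_continuous (f : R -> R) (u : unit_interval R) :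
  {for set_val u, continuous f} ->
  {for u, continuous (fun t : unit_interval R => f (set_val t))}.
Proof.
by apply: (@continuous_comp _ _ _ set_val); exact: initial_continuous.
Qed.

(** The set [E] of the points where every [osc (H n.+1) (V i)] equals [w i]
    accumulates at [u]; along [E] the polynomial in the layered sums tends to
    the left-hand side, and by continuity it tends to its value at [u]. *)
Lemma meval_layered_sum_cluster H k (P : mpoly k R) (V : 'I_k -> nat -> R)
    (w : 'I_k -> R) n (u : unit_interval R) :
  (forall n, closed (H n)) -> (forall j k, (j <= k)%N -> H j `<=` H k) ->
  (forall i j, 0 <= V i j <= 1) ->
  H n.+1 (set_val u) -> ~ H n (set_val u) ->
  (forall j0, exists2 j, (j0 <= j)%N & forall i, V i j = w i) ->
  let Phi (t : unit_interval R) :=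
    meval (fun i => layered_sum H (V i) (set_val t)) P in
  {for u, continuous Phi} ->
  meval (fun i => 2^-1 ^+ n * tdist (H n) (set_val u) * w i +
                  other_layers H (V i) n (set_val u)) P = Phi u.
Proof.
move=> cH mH V01 Hu nHu hits Phi cPhi.
pose E := [set t : unit_interval R | forall i,
  osc (H n.+1) (V i) (set_val t) = w i].
have clE : closure E u.
  move=> B /nbhs_ballP[e /= e0 eB].
  have u01 : 0 <= set_val u <= 1 by have := set_valP u; rewrite /= in_itv.
  have [j0 H0] := osc_attains (cH n.+1) Hu u01 e0.
  have [j /H0[y [y01 uy oy]] Vw] := hits j0.
  have yI : y \in (`[0, 1]%classic : set R) by rewrite mem_set //= in_itv.
  exists (SigSub yI); split; first by move=> i; rewrite oy Vw.
  exact: eB.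
have PF : ProperFilter (within E (nbhs u)) by exact: within_nbhs_proper.
have Phi_u : Phi t @[t --> within E (nbhs u)] --> Phi u.
  exact: cvg_within_filter cPhi.
have hR : hausdorff_space R by exact: Rhausdorff.
apply: (cvg_unique hR (F := Phi t @[t --> within E (nbhs u)]) _ Phi_u) => //.
apply: meval_cvg => i.
have layersE : \forall t \near within E (nbhs u),
    2^-1 ^+ n * tdist (H n) (set_val t) * w i +
      other_layers H (V i) n (set_val t)
    = layered_sum H (V i) (set_val t).
  apply: filterS (near_withinT _ _) => t Et.
  by rewrite (layered_sum_split _ n) // /layer Et.
apply: cvg_trans (near_eq_cvg layersE) _.
have cval (f : R -> R) : {for set_val u, continuous f} ->
    f (set_val t) @[t --> within E (nbhs u)] --> f (set_val u).
  by move=> cf; apply: cvg_within_filter; exact: comp_set_val_continuous.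
apply: cvgD; last by apply: cval; exact: other_layers_continuous.
apply: cvgM; last exact: cvg_cst.
apply: cvgM; first exact: cvg_cst.
by apply: cval; exact: tdist_continuous.
Qed.

Lemma meval_layered_sum_continuous H k (P : mpoly k R) (V : 'I_k -> nat -> R)
    (u : unit_interval R) :
  (forall n, closed (H n)) -> (forall i j, 0 <= V i j <= 1) ->
  (forall n, ~ H n (set_val u)) ->
  {for u, continuous (fun t : unit_interval R =>
    meval (fun i => layered_sum H (V i) (set_val t)) P)}.
Proof.
move=> cH V01 nHu; apply: (@meval_cvg _ _ (nbhs u)) => i.
apply: (comp_set_val_continuous (f := layered_sum H (V i))).
exact: layered_sum_continuous.
Qed.

End LayeredSum.

(** * Strong algebrability of the functions continuous exactly on a set *)

(** The polynomial [X_0 - X_1] shows that [f] is injective, so that its range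
    has the cardinality of the continuum. *)
Lemma strongly_algebrable_family (R : realType) (A : comAlgType R)
    (S : set A) (f : set nat -> A) :
  (forall (k : nat) (P : mpoly k R) (B : 'I_k -> set nat),
    P != 0 -> mcoeff mnm0 P = 0 -> injective B ->
    let Q := mmap (in_alg A) (f \o B) P in Q != 0 /\ S Q) ->
  strongly_algebrable continuum S.
Proof.
move=> fP.
have f_inj : injective f.
  move=> B C fBC; apply: contrapT => neqBC.
  pose D (i : 'I_2) := if i == ord0 then B else C.
  pose P : mpoly 2 R := mpolyX R (mnm1 ord0) - mpolyX R (mnm1 ord_max).
  have [|||+ _] := fP 2%N P D.
  - apply/eqP => /(congr1 (mcoeff (mnm1 ord0))).
    rewrite mcoeffB !mcoeffXU mcoeff0 /=.
    by move/eqP; rewrite subr0 oner_eq0.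
  - by rewrite mcoeffB !mcoeffX !mnm1_eq0 subrr.
  - move=> i j; rewrite /D.
    have [->|i0] := eqVneq i ord0; have [->|j0] := eqVneq j ord0 => //.
    + by move=> e; case: neqBC; rewrite e.
    + move=> _; apply/val_inj; move: i0 j0 (ltn_ord i) (ltn_ord j).
      by rewrite -!val_eqE /=; lia.
  by rewrite raddfB /= !mmapX !mmap1U /D /= fBC subrr eqxx.
exists (range f).
  by apply: inj_card_eq => B C _ _; exact: f_inj.
move=> k P y _ P0 P00 y_inj yX.
have [B fB] : exists B : 'I_k -> set nat, y = f \o B.
  have /choice[B HB] : forall i, exists B, f B = y i.
    by move=> i; have [B _ <-] := yX i; exists B.
  by exists B; apply/funext => i /=; rewrite HB.
rewrite fB; apply: fP => // i j Bij.
by apply: y_inj; rewrite fB /= Bij.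
Qed.

(** The generators for the case of functions continuous everywhere. *)
Definition recip_tent (R : realType) (A : set nat) (y : R) : R :=
  tent (weight R A) `|y|^-1.

(** At [0] this holds because the crest [weight R A k], reached near
    [|y| = 1 / (k + 1/2)], is at most [1 / (k + 1)]. *)
Lemma recip_tent_continuous (R : realType) (A : set nat) :
  continuous (@recip_tent R A).
Proof.
rewrite /recip_tent.
have tent0 (y : R) : y = 0 -> tent (weight R A) `|y|^-1 = 0.
  by move=> ->; rewrite normr0 invr0 /tent truncn0 subrr min_l ?mulr0 // subr0.
move=> x; have [x0|x0] := eqVneq x 0; last first.
  apply: (@continuous_comp _ _ _ (fun y : R => `|y|^-1) (tent (weight R A))).
    by apply: cvgV; [rewrite normr_eq0|exact: norm_continuous].
  by apply: tent_continuous; [exact: weight_unit|rewrite invr_gt0 normr_gt0].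
have small y :
    `|tent (weight R A) `|x|^-1 - tent (weight R A) `|y|^-1| <= `|x - y|.
  rewrite (tent0 _ x0) x0 !sub0r !normrN.
  have [y0|y0] := eqVneq y 0; first by rewrite (tent0 _ y0) normr0.
  have z0 : 0 <= `|y|^-1 by rewrite invr_ge0.
  have [t0 t1 _ _] := tent_bounds (@weight_unit R A) z0.
  rewrite ger0_norm //; apply: le_trans t1 _.
  have /andP[_ /le_trans] := weight_bounds R A (Num.truncn `|y|^-1); apply.
  rewrite -[leRHS]invrK lef_pV2 ?posrE ?invr_gt0 ?normr_gt0 ?ltr0n //.
  exact/ltW/truncnS_gt.
apply/cvgrPdist_le => e e0; near=> y; apply: le_trans (small y) _; near: y.
by apply: cvgr_dist_le => //; exact: cvg_id.
Unshelve. all: by end_near. Qed.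

Lemma continuity_points_unit_intervalP (R : realType) (G : set R)
    (f : unit_interval R -> R) : G `<=` `[0, 1] ->
  (forall u, {for u, continuous f} <-> G (set_val u)) ->
  functions_continuous_exactly_on G f.
Proof.
move=> G01 fG; apply/seteqP; split => [_ [u fu <-]|x Gx]; first exact/fG.
have xI : x \in (`[0, 1]%classic : set R) by rewrite mem_set //; exact: G01.
by exists (SigSub xI) => //; apply/fG.
Qed.

Theorem theorem3p4 (R : realType) (G : set R) :
  G `<=` `[0, 1] -> Gdelta G ->
  @strongly_algebrable R (unit_interval R -> R) continuum
    (@functions_continuous_exactly_on R G).
Proof.
move=> G01 [U oU GU].
have [[x0 [x01 nGx0]]|allG] :=
  pselect (exists x, `[0, 1]%classic x /\ ~ G x); last first.
  apply: (@strongly_algebrable_family _ _ _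
    (fun A (u : unit_interval R) => recip_tent A (2 * set_val u))).
  move=> k P B P0 P00 B_inj Q.
  have QE u : Q u = meval (fun i => recip_tent (B i) (2 * set_val u)) P.
    exact: mmap_fctE.
  split.
    apply/eqP => Q0; apply: (@weight_independent R k P B (fun=> 0) 1 0) => // j.
    have j0 : 0 < j%:R + 2^-1 :> R by rewrite ltr_wpDl.
    (* The factor 2 in the generators puts all the points where the waves
       reach their crests inside [0, 1]. *)
    pose y : R := (2 * (j%:R + 2^-1))^-1.
    have yI : y \in (`[0, 1]%classic : set R).
      rewrite mem_set //= in_itv /= invr_ge0 mulr_ge0 ?(ltW j0) //=.
      by rewrite invf_le1 ?mulr_gt0 // mulrDr divff // lerDr mulr_ge0.
    transitivity (Q (SigSub yI)); last by rewrite Q0.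
    rewrite QE; apply: meval_eq => i.
    rewrite mul1r addr0 -[set_val _]/y /y invfM mulrA divff // mul1r.
    by rewrite /recip_tent gtr0_norm ?invr_gt0 // invrK tent_half.
  apply: continuity_points_unit_intervalP => // u; split => _.
    apply: contrapT => nGu; apply: allG; exists (set_val u).
    by split => //; exact: set_valP.
  have -> : Q = fun u => meval (fun i => recip_tent (B i) (2 * set_val u)) P.
    by apply/funext.
  apply: (@meval_cvg _ _ (nbhs u)) => i.
  apply: (comp_set_val_continuous (f := fun y => recip_tent (B i) (2 * y))).
  exact: (@continuous_comp R R R ( *%R 2) (@recip_tent R (B i)) _
    (@mulrl_continuous _ _ _) (@recip_tent_continuous _ _ _)).
pose H n : set R := \bigcup_(i < n) ~` U i.
have HP n x : H n x <-> exists2 i, (i < n)%N & ~ U i x.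
  by split=> [[i ? ?]|[i ? ?]]; exists i.
have cH n : closed (H n).
  by apply: closed_bigcup => // i _; exact: open_closedC.
have mH j k : (j <= k)%N -> H j `<=` H k.
  move=> jk x /HP[i ij Ui]; apply/HP; exists i => //; exact: leq_trans jk.
pose f A (u : unit_interval R) :=
  layered_sum H (fun k => weight R A (stage k)) (set_val u).
apply: (@strongly_algebrable_family _ _ _ f) => k P B P0 P00 B_inj Q.
pose V i k := weight R (B i) (stage k).
have V01 i j : 0 <= V i j <= 1 by exact: weight_unit.
have QE : Q = fun u => meval (fun i => layered_sum H (V i) (set_val u)) P.
  by apply/funext => u; exact: mmap_fctE.
have cQ u : {for u, continuous Q} <-> G (set_val u).
  split=> [cu|Gu]; last first.
    rewrite QE; apply: meval_layered_sum_continuous => // n /HP[i _]; apply.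
    by move: Gu; rewrite GU; apply.
  rewrite GU => m _; apply: contrapT => nUm.
  have [n Hn nHn] : exists2 n, H n.+1 (set_val u) & ~ H n (set_val u).
    have ex : exists n, `[< H n (set_val u) >].
      by exists m.+1; apply/asboolP/HP; exists m.
    case: (ex_minnP ex) => -[|n] /asboolP Hn min_n; first by have /HP[] := Hn.
    exists n => // /asboolP/min_n; by rewrite ltnn.
  apply: (@weight_independent R k P B
    (fun i => other_layers H (V i) n (set_val u))
    (2^-1 ^+ n * tdist (H n) (set_val u)) (Q u)) => //.
    by rewrite mulf_neq0 ?expf_neq0 ?invr_eq0 // gt_eqF // tdist_gt0.
  move=> j; rewrite QE; apply: (meval_layered_sum_cluster (V := V)) => //.
    move=> j0; have [l jl lj] := stage_recurrent j j0.
    by exists l => // i; rewrite /V lj.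
  by rewrite -QE.
split; last exact: continuity_points_unit_intervalP.
apply/eqP => Q0.
have xI : x0 \in (`[0, 1]%classic : set R) by rewrite mem_set.
apply: nGx0; apply: (cQ (SigSub xI)).1; rewrite Q0.
by apply: (@cst_continuous _ R 0).
Qed.
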